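(* Let the plant graph $G_{\mathcal P}=(\{1,\dots,q\},E_{\mathcal P})$ and the design graph $G_{\mathcal C}=(\{1,\dots,q\},E_{\mathcal C})$ be given and let $G_{\mathcal K}\supseteq G_{\mathcal P}$. If one of the following conditions is satisfied, then $r_{\mathcal P}(\Gamma)\ge 1+1/\epsilon^2$ for all $\Gamma\in\mathcal C$: (a) $G_{\mathcal P}$ contains the path $k\to i\to j$ with distinct nodes $i$, $j$, and $k$ (i.e. $(k,i),(i,j)\in E_{\mathcal P}$) while $(j,i)\notin E_{\mathcal C}$. (b) There exist $i\ne j$ such that $n_i\ge 2$ and $(i,j)\in E_{\mathcal P}$ while $(j,i)\notin E_{\mathcal C}$.
   Context: Fix integers $q\ge 1$ and $n_1,\dots,n_q\ge 1$, put $n=\sum_{i=1}^q n_i$, and fix a real $\epsilon>0$. Matrices $M\in\mathbb R^{n\times n}$ are partitioned into blocks $M_{ij}\in\mathbb R^{n_i\times n_j}$, $1\le i,j\le q$. Graphs are directed with vertex set $\{1,\dots,q\}$, possibly with self-loops. The adjacency matrix $S=(s_{ij})$ of $G=(\{1,\dots,q\},E)$ is $s_{ij}=1$ if $(j,i)\in E$ and $s_{ij}=0$ otherwise. $G'\supseteq G$ means the edge set of $G'$ contains that of $G$. Plants: given the plant graph $G_{\mathcal P}$ with adjacency matrix $S_{\mathcal P}$, let $\mathcal A(S_{\mathcal P})=\{A\in\mathbb R^{n\times n}: A_{ij}=0 \text{ whenever } (s_{\mathcal P})_{ij}=0\}$, and let $\mathcal B(\epsilon)$ be the set of diagonal $n\times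 n$ matrices with all diagonal entries $\ge\epsilon$. The set of plants is $\mathcal P=\mathcal A(S_{\mathcal P})\times\mathcal B(\epsilon)\times\mathbb R^n$; $P=(A,B,x_0)$ stands for the system $x(k+1)=Ax(k)+Bu(k)$, $x(0)=x_0$. Controllers: given the control graph $G_{\mathcal K}$ with adjacency matrix $S_{\mathcal K}$, let $\mathcal K=\{K\in\mathbb R^{n\times n}: K_{ij}=0 \text{ whenever } (s_{\mathcal K})_{ij}=0\}$; $K$ acts by $u(k)=Kx(k)$. Cost: $J_P(K)=\sum_{k=1}^\infty x(k)^Tx(k)+\sum_{k=0}^\infty u(k)^Tu(k)\in[0,\infty]$, evaluated along the closed loop of $P$ with $u=Kx$. Design methods: a control design method is a map $\Gamma:\mathcal A(S_{\mathcal P})\times\mathcal B(\epsilon)\to\mathcal K$. Given a design graph $G_{\mathcal C}$ with adjacency matrix $S_{\mathcal C}$, $\mathcal C$ is the set of control design methods $\Gamma$ with structure $G_{\mathcal C}$, meaning that for each $i$ the block row $[\Gamma_{i1}\ \cdots\ \Gamma_{iq}]$ is a function only of $\{[A_{j1}\ \cdots\ A_{jq}],\,B_{jj}: (s_{\mathcal C})_{ij}\ne 0\}$. Competitive ratio: it is assumed that for every $P\in\mathcal P$ there is an optimal controller $K^*(P)\in\mathcal K$, i.e. $J_P(K^*(P))\le J_P(K)$ for all $K\in\mathcal K$. Set $$r_{\mathcal P}(\Gamma)=\sup_{P=(A,B,x_0)\in\mathcal P}\frac{J_P(\Gamma(A,B))}{J_P(K^*(P))},$$ with the conventions $0/0=1$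 and $c/0=\infty$ for $c>0$.
   Formalization: Condition (b) additionally requires that node i has at least one incoming edge in the plant graph (a self-loop at i suffices); without this, (b) is false, e.g. for q=2, n=(2,1), E_P=E_K={(1,2)}, E_C={(1,2),(2,2)}. *)

(* Defs.v *)
From HB Require Import structures.
From mathcomp Require Import all_boot all_order all_algebra.
From mathcomp Require Import all_classical all_reals all_analysis.

Set Implicit Arguments.
Unset Strict Implicit.
Unset Printing Implicit Defensive.

Import Order.TTheory GRing.Theory Num.Theory.
Local Open Scope classical_set_scope.
Local Open Scope ring_scope.

(* A directed graph on q vertices is its edge relation: [E j i] means that
   (j, i) is an edge, directed from j to i.  Note the transposition. *)
Definition adjacency (q : nat) (E : rel 'I_q) : 'M[nat]_q :=
  \matrix_(i, j) nat_of_bool (E j i).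

Section Blocks.
Variables (R : realType) (q : nat) (n : 'I_q -> nat).

Definition state := 'cV[R]_(\sum_(i < q) n i).
Definition sqmx := 'M[R]_(\sum_(i < q) n i).

Definition blk (M : sqmx) (i j : 'I_q) : 'M[R]_(n i, n j) := submxblock M i j.

(* The set called A(S_P) for plants and K for controllers. *)
Definition structured (S : 'M[nat]_q) : set sqmx :=
  [set M | forall i j, S i j = 0%N -> blk M i j = 0].

Definition input_matrices (eps : R) : set sqmx :=
  [set B | is_diag_mx B /\ forall l, eps <= B l l].

(* A plant is a triple (A, B, x0). *)
Definition plant : Type := (sqmx * sqmx * state)%type.

Definition plants (SP : 'M[nat]_q) (eps : R) : set plant :=
  structured SP `*` input_matrices eps `*` [set: state].

Definition closed_loop_step (A B K : sqmx) (x : state) : state :=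
  A *m x + B *m (K *m x).

Definition trajectory (P : plant) (K : sqmx) (k : nat) : state :=
  iter k (closed_loop_step P.1.1 P.1.2 K) P.2.

Definition input (P : plant) (K : sqmx) (k : nat) : state :=
  K *m trajectory P K k.

Definition sqnorm (x : state) : R := (x^T *m x) 0 0.

Definition cost (P : plant) (K : sqmx) : \bar R :=
  (\sum_(1 <= k <oo) (sqnorm (trajectory P K k))%:E
   + \sum_(0 <= k <oo) (sqnorm (input P K k))%:E)%E.

(* A design method is a total function on matrices; only its values on
   [structured SP `*` input_matrices eps] are constrained or used. *)
Definition design_method := sqmx -> sqmx -> sqmx.

Definition is_design_method (SP SK : 'M[nat]_q) (eps : R)
    (Gamma : design_method) : Prop :=
  forall A B, structured SP A -> input_matrices eps B ->
    structured SK (Gamma A B).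

Definition has_design_structure (SP SC : 'M[nat]_q) (eps : R)
    (Gamma : design_method) : Prop :=
  forall (i : 'I_q) (A A' B B' : sqmx),
    structured SP A -> input_matrices eps B ->
    structured SP A' -> input_matrices eps B' ->
    (forall j, SC i j <> 0%N ->
       (forall l, blk A j l = blk A' j l) /\ blk B j j = blk B' j j) ->
    forall l, blk (Gamma A B) i l = blk (Gamma A' B') i l.

Definition design_methods (SP SK SC : 'M[nat]_q) (eps : R) :
    set design_method :=
  [set Gamma | is_design_method SP SK eps Gamma /\
               has_design_structure SP SC eps Gamma].

Definition is_optimal (SK : 'M[nat]_q) (P : plant) (K : sqmx) : Prop :=
  structured SK K /\ forall K', structured SK K' -> (cost P K <= cost P K')%E.

(* Division on [0, +oo] with 0 / 0 = 1 and c / 0 = +oo for c > 0. The library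
   value +oo / +oo = 0 is never met by [competitive_ratio] when the control
   graph contains the plant graph: - B^-1 A is then an admissible controller
   of finite cost, so that optimal costs are finite. *)
Definition cost_ratio (x y : \bar R) : \bar R :=
  (if y == 0 then (if x == 0 then 1 else +oo) else x / y)%E.

Definition competitive_ratio (SP : 'M[nat]_q) (eps : R)
    (Kstar : plant -> sqmx) (Gamma : design_method) : \bar R :=
  ereal_sup [set cost_ratio (cost P (Gamma P.1.1 P.1.2)) (cost P (Kstar P))
            | P in plants SP eps].

End Blocks.

(* Main.v *)
(* Choose state coordinates a, b, c with b in block i, c in block j, a <> b and b <> c (a = c
   is allowed), and let A map e_a to e_b and e_b to s e_c, with B = eps I and x0 = e_a.
   Block row i of the controller cannot depend on s, hence neither can y = x_b(1).  If
   y <> 0, then c is hit by s y at the second step, so that for large s the cost of Gamma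
   exceeds the cost 1 / eps^2 of the deadbeat controller - B^-1 A by an arbitrary factor.
   If y = 0, then for s = 0 Gamma spends at least 1 / eps^2, whereas the controller
   - eps / (1 + eps^2) A only costs 1 / (1 + eps^2). *)
Require Import Defs.
From HB Require Import structures.
From mathcomp Require Import all_boot all_order all_algebra.
From mathcomp Require Import all_classical all_reals all_analysis.
From mathcomp Require Import ring lra.

Set Implicit Arguments.
Unset Strict Implicit.
Unset Printing Implicit Defensive.

Import Order.TTheory GRing.Theory Num.Theory.
Local Open Scope classical_set_scope.
Local Open Scope ring_scope.

Section Blocks.
Variables (R : realType) (q : nat) (n : 'I_q -> nat).
Local Notation N := (\sum_(i < q) n i)%N.
Local Notation block_of := (@tagnat.sig1 q n).
Implicit Types (A B K M : sqmx R n) (S : 'M[nat]_q) (x : state R n) (P : plant R n).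

(** * Block sparsity, read coordinate by coordinate *)

Lemma structuredP S M :
  structured S M <->
  forall l m : 'I_N, S (block_of l) (block_of m) = 0%N -> M l m = 0.
Proof.
split=> [SM l m Slm|SM i j Sij].
  have /matrixP/(_ (tagnat.sig2 l) (tagnat.sig2 m)) := SM _ _ Slm.
  by rewrite !mxE !tagnat.sig2K.
by apply/matrixP => k l; rewrite !mxE; apply: SM; rewrite !tagnat.Rank1K.
Qed.

Lemma structuredZ S t M : structured S M -> structured S (t *: M).
Proof.
by move=> /structuredP SM; apply/structuredP => l m /SM; rewrite mxE => ->; rewrite mulr0.
Qed.

Lemma structured_subrel (E E' : rel 'I_q) M : (forall i j, E i j -> E' i j) ->
  structured (adjacency E) M -> structured (adjacency E') M.
Proof.
move=> EE' /structuredP EM; apply/structuredP => l m; rewrite mxE => E'0.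
by apply: EM; rewrite mxE; case: (boolP (E _ _)) => // /EE'; move: E'0; case: (E' _ _).
Qed.

Lemma scalar_input_matrices (eps : R) : input_matrices eps (eps%:M : sqmx R n).
Proof.
by split=> [|l]; [exact: scalar_mx_is_diag|rewrite mxE eqxx].
Qed.

(** * Bounds on the cost and on the competitive ratio *)

Lemma sqnormE x : sqnorm x = \sum_l x l 0 ^+ 2.
Proof. by rewrite /sqnorm mxE; apply: eq_bigr => l _; rewrite mxE expr2. Qed.

Lemma sqnorm_ge0 x : 0 <= sqnorm x.
Proof. by rewrite sqnormE sumr_ge0 // => l _; rewrite sqr_ge0. Qed.

Lemma sqnorm_ge_coord x l : x l 0 ^+ 2 <= sqnorm x.
Proof. by rewrite sqnormE (bigD1 l) //= lerDl sumr_ge0 // => m _; rewrite sqr_ge0. Qed.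

Lemma sqnormZ t x : sqnorm (t *: x) = t ^+ 2 * sqnorm x.
Proof. by rewrite !sqnormE mulr_sumr; apply: eq_bigr => l _; rewrite mxE exprMn. Qed.

Lemma sqnorm0 : sqnorm (0 : state R n) = 0.
Proof. by rewrite sqnormE big1 // => l _; rewrite mxE expr0n. Qed.

Lemma sqnorm_delta l : sqnorm (delta_mx l 0 : state R n) = 1.
Proof.
rewrite sqnormE (bigD1 l) //= mxE !eqxx expr1n [X in _ + X]big1 ?addr0 // => m /negPf ml.
by rewrite mxE ml expr0n.
Qed.

Lemma trajectoryS P K k :
  trajectory P K k.+1 = P.1.1 *m trajectory P K k + P.1.2 *m input P K k.
Proof. by []. Qed.

Lemma cost_ge0 P K : (0 <= cost P K)%E.
Proof. by apply: adde_ge0; apply: nneseries_ge0 => k _ _; rewrite lee_fin sqnorm_ge0. Qed.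

Lemma cost_ge_step P K k (l : 'I_N) :
  ((trajectory P K k.+1 l 0 ^+ 2 + input P K k l 0 ^+ 2)%:E <= cost P K)%E.
Proof.
have term (f : nat -> state R n) m j : (m <= j)%N ->
    ((f j l 0 ^+ 2)%:E <= \sum_(m <= i <oo) (sqnorm (f i))%:E)%E.
  move=> mj; apply: le_trans (nneseries_lim_ge j.+1 _); last first.
    by move=> i _ _; rewrite lee_fin sqnorm_ge0.
  rewrite big_nat_recr //=; apply: lee_paddl.
    by apply: sume_ge0 => i _; rewrite lee_fin sqnorm_ge0.
  by rewrite lee_fin sqnorm_ge_coord.
by rewrite EFinD; apply: leeD; apply: term.
Qed.

(** With drift a in coordinate [l], any input u costs at least the minimum of (a + eps u)^2 + u^2,
    reached at u = - eps a / (1 + eps^2). *)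
Lemma cost_ge_min A (eps : R) x K k (l : 'I_N) : 0 < eps ->
  (((A *m trajectory (A, eps%:M, x) K k) l 0 ^+ 2 / (1 + eps ^+ 2))%:E
     <= cost (A, eps%:M, x) K)%E.
Proof.
move=> eps0; apply: le_trans (cost_ge_step _ _ k l); rewrite lee_fin.
rewrite trajectoryS /= mul_scalar_mx.
set a := (_ *m _) l 0; set u := input _ _ _ _ _.
have -> : (A *m trajectory (A, eps%:M, x) K k
           + eps *: input (A, eps%:M, x) K k) l 0 = a + eps * u.
  by rewrite mxE [X in _ + X]mxE.
have e2 : 0 < 1 + eps ^+ 2 by rewrite ltr_pwDl // sqr_ge0.
rewrite ler_pdivrMr // -subr_ge0.
(* The gap to the minimum is a perfect square, vanishing exactly at the minimiser. *)
have -> : ((a + eps * u) ^+ 2 + u ^+ 2) * (1 + eps ^+ 2) - a ^+ 2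
          = (eps * a + (1 + eps ^+ 2) * u) ^+ 2 by ring.
exact: sqr_ge0.
Qed.

(** The closed loop matrix is (1 - eps t) A, so the hypothesis kills the state from time 2 on and
    the input from time 1 on; only x(1) and u(0) are paid for. It holds if t = 1 / eps (deadbeat),
    or for any t if A^2 x = 0. *)
Lemma cost_proportional A (eps t : R) x :
  (1 - eps * t) *: (A *m (A *m x)) = 0 ->
  cost (A, eps%:M, x) (- t *: A)
    = (((1 - eps * t) ^+ 2 + t ^+ 2) * sqnorm (A *m x))%:E.
Proof.
move=> AAx; set P := (A, eps%:M, x); set K := - t *: A.
have step k : trajectory P K k.+1 = (1 - eps * t) *: (A *m trajectory P K k).
  rewrite trajectoryS /input /= mul_scalar_mx -scalemxAl scalerA.
  by rewrite -{1}[A *m _]scale1r -scalerDl mulrN.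
have traj1 : trajectory P K 1 = (1 - eps * t) *: (A *m x) by rewrite step.
have traj2 k : trajectory P K k.+2 = 0.
  elim: k => [|k IH]; rewrite step ?IH.
    by rewrite traj1 -scalemxAr AAx scaler0.
  by rewrite mulmx0 scaler0.
have input0 k : input P K k.+1 = 0.
  rewrite /input; case: k => [|k]; last by rewrite traj2 mulmx0.
  by rewrite traj1 -scalemxAl -scalemxAr AAx scaler0.
have sq0 (y : state R n) : (0 <= (sqnorm y)%:E)%E by rewrite lee_fin sqnorm_ge0.
rewrite /cost (nneseries_split 1 1) // (nneseries_split 0 1) // !big_nat1.
rewrite !eseries0 => [|[|k] // _ _|[|[|k]] // _ _]; last 2 first.
- by rewrite input0 sqnorm0.
- by rewrite traj2 sqnorm0.
rewrite !adde0 traj1 /input /= -scalemxAl !sqnormZ -EFinD.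
by congr EFin; ring.
Qed.

(** The cost of any admissible controller can serve as [M], so the optimum itself is never computed;
    as [M] is finite, the quotient +oo / +oo does not arise. *)
Lemma competitive_ratio_ge S (eps c M : R) (Kstar : plant R n -> sqmx R n)
    (Gamma : design_method R n) P :
  plants S eps P -> 0 < c -> 0 < M ->
  ((c * M)%:E <= cost P (Gamma P.1.1 P.1.2))%E -> (cost P (Kstar P) <= M%:E)%E ->
  (c%:E <= competitive_ratio S eps Kstar Gamma)%E.
Proof.
move=> SP c0 M0 leG leK; apply: le_trans (ereal_sup_ubound _); last by exists P.
have := cost_ge0 P (Kstar P); rewrite /cost_ratio.
have G0 : (0 < cost P (Gamma P.1.1 P.1.2))%E.
  by apply: lt_le_trans leG; rewrite lte_fin mulr_gt0.
(* If the optimal cost is 0, the positive cost of [Gamma] makes the ratio +oo. *)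
case: eqP leK => [_ _ _|/eqP y0 leK y_ge0]; first by rewrite gt_eqF // leey.
case: (cost P (Kstar P)) y0 leK y_ge0 => [y| |] //; rewrite eqe !lee_fin => y0 yM y_ge0.
have ygt0 : 0 < y by rewrite lt_def y0.
rewrite inver (negPf y0) lee_pdivlMr //; apply: le_trans leG.
by rewrite -EFinM lee_fin ler_wpM2l // ltW.
Qed.

(** * Choice of the coordinates a, b, c and the relay plants *)

Lemma relay_coordinates (EP EC : rel 'I_q) :
  (forall i, (1 <= n i)%N) ->
  (exists i j k, [/\ i != j, j != k & i != k] /\ [/\ EP k i, EP i j & ~~ EC j i]) \/
  (exists i j, i != j /\ (2 <= n i)%N /\ (exists k, EP k i) /\ EP i j /\ ~~ EC j i) ->
  exists a b c : 'I_N,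
    [/\ a != b, block_of b != block_of c,
        adjacency EP (block_of b) (block_of a) <> 0%N,
        adjacency EP (block_of c) (block_of b) <> 0%N &
        adjacency EC (block_of b) (block_of c) = 0%N].
Proof.
move=> hn hcond; pose coord i : 'I_N := tagnat.Rank i (Ordinal (hn i)).
(* Take for b and c the first coordinates of blocks i and j; a must differ from b and lie in a block
   with an edge to i. *)
suff [i [j [a [ij ai Eai Eij /negPf ECji]]]] : exists i j (a : 'I_N),
    [/\ i != j, a != coord i, EP (block_of a) i, EP i j & ~~ EC j i].
  by exists a, (coord i), (coord j); rewrite !tagnat.Rank1K !mxE Eai Eij ECji.
have coord_neq i k : i != k -> coord k != coord i.
  by apply: contra_neq => /(congr1 block_of); rewrite !tagnat.Rank1K.
case: hcond => [[i [j [k [[ij _ ik] [Eki Eij ECji]]]]]|].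
  by exists i, j, (coord k); rewrite tagnat.Rank1K coord_neq.
move=> [i [j [ij [ni2 [[k Eki] [Eij ECji]]]]]].
have [ik|ik] := eqVneq i k; last first.
  by exists i, j, (coord k); rewrite tagnat.Rank1K coord_neq.
rewrite -ik in Eki.
(* The edge into i is a self-loop: a is the second coordinate of block i, available since n_i >=
   2. *)
exists i, j, (tagnat.Rank i (Ordinal ni2)); rewrite tagnat.Rank1K; split=> //.
apply/eqP => /(congr1 (@nat_of_ord _)); rewrite !tagnat.RankEsum => /eqP.
by rewrite eqn_add2l.
Qed.

Section Relay.
Variables (a b c : 'I_N).
Hypotheses (ab : a != b) (bc : b != c).

Definition relay (s : R) : sqmx R n := delta_mx b a + s *: delta_mx c b.

Lemma relay_source s : relay s *m (delta_mx a 0 : state R n) = delta_mx b 0.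
Proof.
rewrite mulmxDl -scalemxAl !mul_delta_mx_cond eqxx eq_sym (negPf ab).
by rewrite mulr1n mulr0n scaler0 addr0.
Qed.

Lemma relay_sink s x : (relay s *m x) c 0 = s * x b 0.
Proof.
have rowE (l m r : 'I_N) : (delta_mx l m *m x) r 0 = (r == l)%:R * x m 0.
  rewrite mxE (bigD1 m) //= mxE eqxx andbT [X in _ + X]big1 ?addr0 // => k /negPf km.
  by rewrite mxE km andbF mul0r.
rewrite mulmxDl -scalemxAl mxE [X in _ + X]mxE !rowE eqxx eq_sym (negPf bc).
by rewrite mul0r add0r mul1r.
Qed.

Lemma relay0_nilpotent : relay 0 *m (relay 0 *m (delta_mx a 0 : state R n)) = 0.
Proof.
by rewrite relay_source mulmxDl scale0r mul0mx addr0 mul_delta_mx_cond (negPf ab) mulr0n.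
Qed.

Lemma structured_relay S s :
  S (block_of b) (block_of a) <> 0%N -> S (block_of c) (block_of b) <> 0%N ->
  structured S (relay s).
Proof.
move=> Sba Scb; apply/structuredP => l m S0; rewrite !mxE.
case: (@andP (l == b)) => [[/eqP lb /eqP ma]|_]; first by rewrite lb ma in S0.
case: andP => [[/eqP lc /eqP mb]|_]; first by rewrite lc mb in S0.
by rewrite mulr0 addr0.
Qed.

(** The parameter of [relay] enters only row c, whose block is invisible to the designer of the
    block of b. *)
Lemma design_structure_relay S SC (eps s s' : R) (Gamma : design_method R n) :
  has_design_structure S SC eps Gamma ->
  (forall t, structured S (relay t)) ->
  block_of b != block_of c -> SC (block_of b) (block_of c) = 0%N ->
  forall m, Gamma (relay s) eps%:M b m = Gamma (relay s') eps%:M b m.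
Proof.
move=> hG Sr bcB SC0 m.
have /matrixP/(_ (tagnat.sig2 b) (tagnat.sig2 m)) :
    blk (Gamma (relay s) eps%:M) (block_of b) (block_of m)
    = blk (Gamma (relay s') eps%:M) (block_of b) (block_of m).
  apply: hG => //; do ?exact: scalar_input_matrices.
  move=> j SCj; split=> // l; apply/matrixP => k r; rewrite !mxE.
  have /negPf -> : tagnat.Rank j k != c.
    by apply/eqP => kc; move: SCj; rewrite -[j](tagnat.Rank1K k) kc.
  by rewrite !mulr0.
by rewrite !mxE !tagnat.sig2K.
Qed.

End Relay.

End Blocks.

Theorem theorem4p1 (R : realType) (q : nat) (n : 'I_q -> nat)
    (hq : (1 <= q)%N) (hn : forall i, (1 <= n i)%N)
    (eps : R) (heps : 0 < eps)
    (EP EC EK : rel 'I_q)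
    (hPK : forall i j, EP i j -> EK i j)
    (Kstar : plant R n -> sqmx R n)
    (hKstar : forall P, plants (adjacency EP) eps P ->
       is_optimal (adjacency EK) P (Kstar P))
    (hcond :
       (exists i j k : 'I_q,
          [/\ i != j, j != k & i != k] /\
          [/\ EP k i, EP i j & ~~ EC j i]) \/
       (exists i j : 'I_q,
          i != j /\ (2 <= n i)%N /\
          (* block row i of A is not identically zero on the plants; this
             holds in particular when i has a self-loop *)
          (exists k : 'I_q, EP k i) /\
          EP i j /\ ~~ EC j i))
    (Gamma : design_method R n)
    (hGamma : design_methods (adjacency EP) (adjacency EK) (adjacency EC) eps
       Gamma) :
  ((1 + 1 / eps ^+ 2)%:E
     <= competitive_ratio (adjacency EP) eps Kstar Gamma)%E.
Proof.
have [a [b [c [ab bcB Sba Scb SCbc]]]] := relay_coordinates hn hcond.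
have bc : b != c by apply: contraNneq bcB => ->.
have Sr (s : R) := structured_relay s Sba Scb.
have [_ hG] := hGamma.
pose x0 : state R n := delta_mx a 0.
pose P s : plant R n := (relay a b c s, eps%:M, x0).
have Pplant s : plants (adjacency EP) eps (P s).
  by do 2!split=> //; [exact: Sr|exact: scalar_input_matrices].
have opt s t : (1 - eps * t) *: (relay a b c s *m (relay a b c s *m x0)) = 0 ->
    (cost (P s) (Kstar (P s)) <= ((1 - eps * t) ^+ 2 + t ^+ 2)%:E)%E.
  move=> /cost_proportional; rewrite relay_source // sqnorm_delta mulr1 => <-.
  have [_ opt] := hKstar _ (Pplant s); apply: opt; apply: structuredZ.
  exact: structured_subrel hPK (Sr s).
pose g := Gamma (relay a b c 0) eps%:M b a.
(* As x0 = e_a, this input is the (b, a) entry of the gain, which is the same for all s and so can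
   be read off at s = 0. *)
have inputb s : input (P s) (Gamma (P s).1.1 (P s).1.2) 0 b 0 = g.
  rewrite /g (design_structure_relay 0 s hG Sr bcB SCbc) /input /trajectory /=.
  by rewrite -colE mxE.
have trajb s : trajectory (P s) (Gamma (P s).1.1 (P s).1.2) 1 b 0 = 1 + eps * g.
  rewrite trajectoryS /= relay_source // mul_scalar_mx mxE [X in _ + X]mxE inputb.
  by rewrite mxE !eqxx.
have eps_neq0 : eps != 0 by rewrite gt_eqF.
have e2 : 0 < 1 + eps ^+ 2 by rewrite ltr_pwDl // sqr_ge0.
have e2_neq0 : 1 + eps ^+ 2 != 0 by rewrite gt_eqF.
have ratio_gt0 : 0 < 1 + 1 / eps ^+ 2 by rewrite ltr_pwDl // divr_ge0 // sqr_ge0.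
have [y0|y0] := eqVneq (1 + eps * g) 0.
- have gE : g = - eps^-1 by apply: (mulfI eps_neq0); rewrite mulrN divff //; lra.
  (* Here g^2 = 1 / eps^2 is exactly (1 + 1 / eps^2) times this [M]. *)
  apply: (competitive_ratio_ge (P := P 0) (M := (1 + eps ^+ 2)^-1)) => //.
  + by rewrite invr_gt0.
  + apply: le_trans (cost_ge_step _ _ 0 b).
    rewrite trajb y0 inputb gE lee_fin expr0n /= add0r.
    by rewrite le_eqVlt; apply/orP; left; apply/eqP; field; rewrite eps_neq0 e2_neq0.
  (* This t minimises (1 - eps t)^2 + t^2, with value 1 / (1 + eps^2). *)
  + apply: le_trans (opt 0 (eps / (1 + eps ^+ 2)) _) _.
      by rewrite relay0_nilpotent // scaler0.
    rewrite lee_fin le_eqVlt; apply/orP; left; apply/eqP; field.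
    by rewrite e2_neq0.
(* This s makes the lower bound s^2 y^2 / (1 + eps^2) equal to (1 + 1 / eps^2) / eps^2. *)
- pose s := (1 + eps ^+ 2) / (eps ^+ 2 * (1 + eps * g)).
  apply: (competitive_ratio_ge (P := P s) (M := (eps ^+ 2)^-1)) => //.
  + by rewrite invr_gt0 exprn_gt0.
  + apply: le_trans (cost_ge_min _ _ _ 1 c heps).
    rewrite relay_sink // trajb lee_fin /s.
    rewrite le_eqVlt; apply/orP; left; apply/eqP; field.
    by rewrite y0 eps_neq0 e2_neq0.
  (* The deadbeat choice cancels 1 - eps t, so no nilpotency is required; when a = c and s is
     nonzero, [relay] is indeed not nilpotent. *)
  + apply: le_trans (opt s eps^-1 _) _; first by rewrite divff // subrr scale0r.
    by rewrite divff // subrr expr0n add0r exprVn.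
Qed.
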